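(* There exists a closed subspace $N$ of $L^2(\mathbb{R},e^{-2(e^y-1)}\,dy)$, invariant under all right shifts $S_t$, $t\ge0$, such that $P_-N$ is not closed in $L^2((-\infty,0),e^{-2(e^y-1)}\,dy)$. Specifically, one may take $$N=\overline{\operatorname{span}\{e_{n^2}:\ n\in\mathbb{N}\}}^{\,L^2(\mathbb{R},e^{-2(e^y-1)}\,dy)},\qquad e_\lambda(y)=e^{\lambda y}\quad(y\in\mathbb{R},\ \lambda>0).$$
   Context: $\mathbb{N}=\{1,2,3,\ldots\}$. The right-shift semigroup on $L^2(\mathbb{R},e^{-2(e^y-1)}\,dy)$ is $S_tf(y)=f(y-t)$, $y\in\mathbb{R}$, $t\ge0$. $P_-$ is the orthogonal projection of $L^2(\mathbb{R},e^{-2(e^y-1)}\,dy)$ onto $L^2((-\infty,0),e^{-2(e^y-1)}\,dy)$ (regarded as the subspace of functions vanishing a.e. on $(0,\infty)$), i.e. multiplication by the characteristic function of $(-\infty,0)$. *)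

(* Defs.v *)
From HB Require Import structures.
From mathcomp Require Import all_boot all_order all_algebra.
From mathcomp Require Import all_classical all_reals all_analysis.
From mathcomp Require Import measurable_realfun ring lra complex.

Set Implicit Arguments.
Unset Strict Implicit.
Unset Printing Implicit Defensive.

Import Order.TTheory GRing.Theory Num.Theory.
Import numFieldNormedType.Exports.
Import ComplexField.Normc.

Local Open Scope classical_set_scope.
Local Open Scope ring_scope.
Local Open Scope complex_scope.

Section L2fun.
Context d (T : measurableType d) (R : realType).
Variable mu : {measure set T -> \bar R}.
Implicit Types f g : T -> R[i].

(** The library has no measurable structure on [R[i]]: Borel measurability is
    measurability of the real and imaginary parts. *)
Definition cmeasurable f :=
  measurable_fun setT (fun x => complex.Re (f x)) /\
  measurable_fun setT (fun x => complex.Im (f x)).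

(** [normc z : R] is the modulus; [`|z|] is the same number seen in [R[i]]. *)
Definition cabs f : T -> R := fun x => normc (f x).

Definition L2norme f : \bar R := 'N[mu]_2%:E[EFin \o cabs f]%E.

Definition is_L2fun : {pred T -> R[i]} :=
  mem [set f | cmeasurable f /\ (L2norme f < +oo)%E].

Lemma is_L2funP f :
  f \in is_L2fun <-> cmeasurable f /\ (L2norme f < +oo)%E.
Proof. by rewrite inE. Qed.

Lemma measurable_cabs f : cmeasurable f -> measurable_fun setT (cabs f).
Proof.
move=> [mr mi]; rewrite (_ : cabs f = fun x =>
  Num.sqrt (complex.Re (f x) ^+ 2 + complex.Im (f x) ^+ 2)).
  apply: (@measurableT_comp _ _ _ _ _ _ (@Num.sqrt R)).
    apply: continuous_measurable_fun; exact: sqrt_continuous.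
  by apply: measurable_funD; exact: measurable_funX.
by apply/funext => x; rewrite /cabs; case: (f x).
Qed.

Lemma normcE (z : R[i]) : `|z| = (normc z)%:C.
Proof. by []. Qed.

Lemma normc_ge0 (z : R[i]) : 0 <= normc z.
Proof. by case: z => a b; exact: sqrtr_ge0. Qed.

Lemma ler_normcD (y z : R[i]) : normc (y + z) <= normc y + normc z.
Proof. by rewrite -lecR rmorphD -!normcE ler_normD. Qed.

Lemma Lnorm2_le (f g : T -> R) :
  measurable_fun setT f -> measurable_fun setT g ->
  (forall x, 0 <= f x <= g x) ->
  ('N[mu]_2%:E[EFin \o f] <= 'N[mu]_2%:E[EFin \o g])%E.
Proof.
move=> mf mg fg; rewrite unlock /Lnorm.
apply: gt0_ler_poweR => //.
- by rewrite in_itv/= leey integral_ge0// => x _; exact: poweR_ge0.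
- by rewrite in_itv/= leey integral_ge0// => x _; exact: poweR_ge0.
apply: ge0_le_integral => //.
- by move=> x _; exact: poweR_ge0.
- apply: (measurableT_comp (measurable_poweR _)) => //.
  by apply: measurableT_comp => //; exact/measurable_EFinP.
- apply: (measurableT_comp (measurable_poweR _)) => //.
  by apply: measurableT_comp => //; exact/measurable_EFinP.
- move=> x _ /=; have /andP[f0 fgx] := fg x.
  rewrite lee_fin !ger0_norm ?(le_trans f0)//.
  by apply: ge0_ler_powR => //; rewrite nnegrE// (le_trans f0).
Qed.

Lemma cmeasurableD f g : cmeasurable f -> cmeasurable g -> cmeasurable (f + g).
Proof.
move=> [fr fi] [gr gi]; split.
- rewrite (_ : (fun _ => _) = fun x => complex.Re (f x) + complex.Re (g x)).
    exact: measurable_funD.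
  by apply/funext => x; rewrite /= raddfD.
- rewrite (_ : (fun _ => _) = fun x => complex.Im (f x) + complex.Im (g x)).
    exact: measurable_funD.
  by apply/funext => x; rewrite /= raddfD.
Qed.

Lemma cmeasurableM f g : cmeasurable f -> cmeasurable g ->
  cmeasurable (fun x => f x * g x).
Proof.
move=> [fr fi] [gr gi]; split.
- rewrite (_ : (fun _ => _) = fun x => complex.Re (f x) * complex.Re (g x)
    - complex.Im (f x) * complex.Im (g x)).
    by apply: measurable_funB; exact: measurable_funM.
  by apply/funext => x; case: (f x); case: (g x).
- rewrite (_ : (fun _ => _) = fun x => complex.Re (f x) * complex.Im (g x)
    + complex.Im (f x) * complex.Re (g x)).
    by apply: measurable_funD; exact: measurable_funM.
  by apply/funext => x; case: (f x); case: (g x).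
Qed.

Lemma cmeasurable_cst (c : R[i]) : cmeasurable (cst c).
Proof. by split; exact: measurable_cst. Qed.

Lemma L2normeD f g : cmeasurable f -> cmeasurable g ->
  (L2norme (f + g)%R <= L2norme f + L2norme g)%E.
Proof.
move=> mf mg; have mF := measurable_cabs mf; have mG := measurable_cabs mg.
apply: (@le_trans _ _ ('N[mu]_2%:E[EFin \o (cabs f \+ cabs g)%R])%E).
  apply: Lnorm2_le.
  - exact/measurable_cabs/cmeasurableD.
  - exact: measurable_funD.
  - by move=> x; rewrite normc_ge0 ler_normcD.
by apply: eminkowski => //; rewrite lee_fin ler1n.
Qed.

Lemma L2normeZ (c : R[i]) f : cmeasurable f ->
  (L2norme (c *: f)%R = (normc c)%:E * L2norme f)%E.
Proof.
move=> mf; have mF := measurable_cabs mf.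
have -> : L2norme (c *: f) =
    (((\int[mu]_x ((normc c `^ 2)%:E * (cabs f x `^ 2)%:E)) `^ 2^-1)%E).
  rewrite /L2norme unlock /Lnorm; congr poweR; apply: eq_integral => x _ /=.
  rewrite /cabs normcM ger0_norm ?mulr_ge0 ?normc_ge0//.
  by rewrite powRM ?normc_ge0.
rewrite ge0_integralZl//; last 3 first.
- apply/measurable_EFinP.
  by apply: (measurableT_comp (measurable_powR _)).
- by move=> x _; rewrite lee_fin powR_ge0.
- by rewrite lee_fin powR_ge0.
rewrite poweRM ?lee_fin ?powR_ge0//; last first.
  by apply: integral_ge0 => x _; rewrite lee_fin powR_ge0.
rewrite poweR_EFin -powRrM mulfV// powRr1 ?normc_ge0//.
congr (_ * _)%E; rewrite /L2norme unlock /Lnorm; congr poweR.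
by apply: eq_integral => x _ /=; rewrite ger0_norm ?normc_ge0.
Qed.

Lemma L2norme_ge0 f : (0 <= L2norme f)%E.
Proof. exact: Lnorm_ge0. Qed.

Lemma is_L2fun_submod_closed : submod_closed is_L2fun.
Proof.
split.
  apply/is_L2funP; split; first exact: (cmeasurable_cst 0).
  rewrite /L2norme (_ : EFin \o _ = cst 0%E); first by rewrite Lnorm0// ltry.
  by apply/funext => x; rewrite /= /cabs normc0.
move=> c f g /is_L2funP[mf f2] /is_L2funP[mg g2].
have mcf : cmeasurable (c *: f) by apply: cmeasurableM => //; exact: cmeasurable_cst.
apply/is_L2funP; split; first exact: cmeasurableD.
apply: (le_lt_trans (L2normeD mcf mg)).
by rewrite lte_add_pinfty// L2normeZ// lte_mul_pinfty// ?lee_fin ?normc_ge0.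
Qed.

HB.instance Definition _ :=
  GRing.isSubmodClosed.Build R[i] (T -> R[i]) is_L2fun is_L2fun_submod_closed.

Record L2fun : Type := MkL2fun {
  L2fun_val :> T -> R[i] ;
  L2fun_valP : L2fun_val \in is_L2fun }.

HB.instance Definition _ := [isSub for L2fun_val].
HB.instance Definition _ := [Choice of L2fun by <:].
HB.instance Definition _ := [SubChoice_isSubLmodule of L2fun by <:].

Lemma L2fun_measurable (f : L2fun) : cmeasurable f.
Proof. by have /is_L2funP[] := L2fun_valP f. Qed.

Lemma L2fun_finite (f : L2fun) : (L2norme f < +oo)%E.
Proof. by have /is_L2funP[] := L2fun_valP f. Qed.

Lemma L2norme_fineK (f : L2fun) : (fine (L2norme f))%:E = L2norme f.
Proof. by rewrite fineK// ge0_fin_numE ?L2norme_ge0// L2fun_finite. Qed.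

Definition L2null : {pred L2fun} :=
  mem [set f : L2fun | (f : T -> R[i]) = cst 0 %[ae mu]].

Lemma L2nullP (f : L2fun) :
  f \in L2null <-> (f : T -> R[i]) = cst 0 %[ae mu].
Proof. by rewrite inE. Qed.

Lemma L2null_zmod_closed : zmod_closed L2null.
Proof.
split; first by apply/L2nullP; exact: aeW.
move=> f g /L2nullP f0 /L2nullP g0; apply/L2nullP.
apply: filterS2 f0 g0 => x /= f0 g0 _.
by rewrite -[LHS]/(f x - g x) f0// g0// subrr.
Qed.

HB.instance Definition _ :=
  GRing.isZmodClosed.Build L2fun L2null L2null_zmod_closed.

End L2fun.

Section L2space.
Context d (T : measurableType d) (R : realType).
Variable mu : {measure set T -> \bar R}.

Lemma L2norme_ae (f g : L2fun mu) :
  (f : T -> R[i]) = g %[ae mu] -> L2norme mu f = L2norme mu g.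
Proof.
move=> fg; rewrite /L2norme unlock /Lnorm; congr poweR.
have m (h : L2fun mu) :
    measurable_fun setT (fun x => (`|(EFin \o cabs h) x| `^ 2)%E).
  apply: (measurableT_comp (measurable_poweR _)) => //.
  apply: measurableT_comp => //. apply/measurable_EFinP.
  exact/measurable_cabs/L2fun_measurable.
apply: ge0_ae_eq_integral => //; try exact: m; try by move=> x _; exact: poweR_ge0.
by apply: filterS fg => x /= /(_ I) fg _; rewrite /cabs fg.
Qed.

Lemma L2norme_eq0 (f : L2fun mu) :
  L2norme mu f = 0%E -> (f : T -> R[i]) = cst 0 %[ae mu].
Proof.
move=> f0.
have mf : measurable_fun setT (EFin \o cabs f).
  apply/measurable_EFinP.
  exact/measurable_cabs/L2fun_measurable.
have := @Lnorm_eq0_eq0 _ _ _ _ _ 2%:E mf _ f0.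
rewrite lte_fin ltr0n => /(_ isT).
by apply: filterS => x /= /(_ I)[/eq0_normc].
Qed.

(** Classes modulo [mu]-almost everywhere equality. Working with functions
    instead would make closedness of an image depend on whether that image is
    saturated under almost everywhere equality. *)
Definition L2 : Type := Quotient.quot (@L2null _ T R mu).

HB.instance Definition _ := GRing.Zmodule.on L2.
HB.instance Definition _ := EqQuotient.on L2.

Local Open Scope quotient_scope.

Definition L2class (f : L2fun mu) : L2 := \pi_L2 f.

Definition L2repr (u : L2) : L2fun mu := repr u.

Lemma L2reprK : cancel L2repr L2class.
Proof. by move=> u; rewrite /L2class reprK. Qed.

Lemma L2class_eqP (f g : L2fun mu) :
  L2class f = L2class g <-> (f : T -> R[i]) = g %[ae mu].
Proof.
split=> [/eqP|fg].
  rewrite /L2class -Quotient.idealrBE => /L2nullP.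
  by apply: filterS => x /= /(_ I) fg _; apply/eqP; rewrite -subr_eq0; apply/eqP.
apply/eqP; rewrite /L2class -Quotient.idealrBE; apply/L2nullP.
apply: filterS fg => x /= /(_ I) fg _.
by rewrite -[LHS]/(f x - g x) fg subrr.
Qed.

Lemma L2classK (f : L2fun mu) : (L2repr (L2class f) : T -> R[i]) = f %[ae mu].
Proof. by apply/L2class_eqP; rewrite L2reprK. Qed.

Lemma L2classD (f g : L2fun mu) : L2class (f + g) = L2class f + L2class g.
Proof. exact: raddfD. Qed.

Definition L2scale (c : R[i]) (u : L2) : L2 := L2class (c *: L2repr u).

Lemma L2classZ (c : R[i]) (f : L2fun mu) : L2class (c *: f) = L2scale c (L2class f).
Proof.
apply/L2class_eqP; apply: filterS (L2classK f) => x /= /(_ I) fx _.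
by rewrite -[LHS]/(c * f x) -[RHS]/(c * L2repr (L2class f) x) fx.
Qed.

Lemma L2scaleA (a b : R[i]) (u : L2) : L2scale a (L2scale b u) = L2scale (a * b) u.
Proof. by rewrite -[u]L2reprK -!L2classZ scalerA. Qed.

Lemma L2scale1 : left_id 1 L2scale.
Proof. by move=> u; rewrite -[u]L2reprK -!L2classZ scale1r. Qed.

Lemma L2scaleDr : right_distributive L2scale +%R.
Proof.
move=> c u v; rewrite -[u]L2reprK -[v]L2reprK. rewrite -L2classD -!L2classZ.
by rewrite scalerDr L2classD.
Qed.

Lemma L2scaleDl (u : L2) : {morph L2scale^~ u : a b / a + b}.
Proof. by move=> a b; rewrite -[u]L2reprK -!L2classZ scalerDl L2classD. Qed.

HB.instance Definition _ :=
  GRing.Zmodule_isLmodule.Build R[i] L2 L2scaleA L2scale1 L2scaleDr L2scaleDl.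

(** A normed module over [R[i]] has its norm in [R[i]]. *)
Definition L2norm (u : L2) : R[i] := (fine (L2norme mu (L2repr u)))%:C.

Lemma L2norm_class (f : L2fun mu) :
  L2norm (L2class f) = (fine (L2norme mu f))%:C.
Proof. by rewrite /L2norm (L2norme_ae (L2classK f)). Qed.

Lemma L2norm_triangle (u v : L2) : L2norm (u + v) <= L2norm u + L2norm v.
Proof.
rewrite -[u]L2reprK -[v]L2reprK -L2classD !L2norm_class -rmorphD lecR.
rewrite -lee_fin EFinD !L2norme_fineK; apply: L2normeD; exact: L2fun_measurable.
Qed.

Lemma L2normZ (c : R[i]) (u : L2) : L2norm (c *: u) = `|c| * L2norm u.
Proof.
rewrite -[u]L2reprK -[c *: _]L2classZ !L2norm_class normcE -rmorphM.
congr (_%:C); apply: EFin_inj; rewrite EFinM !L2norme_fineK L2normeZ//.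
exact: L2fun_measurable.
Qed.

Lemma L2norm_eq0 (u : L2) : L2norm u = 0 -> u = 0.
Proof.
move=> u0.
have h : fine (L2norme mu (L2repr u)) = 0.
  exact: (congr1 (@complex.Re R) u0).
have {}h : L2norme mu (L2repr u) = 0%E by rewrite -L2norme_fineK h.
have {}h := L2norme_eq0 h.
by rewrite -[LHS]L2reprK -[0](raddf0 (\pi_L2)); apply/L2class_eqP.
Qed.

HB.instance Definition _ :=
  Lmodule_isNormed.Build R[i] L2 L2norm_triangle L2normZ L2norm_eq0.

Lemma L2_normE (f : L2fun mu) : `|L2class f| = (fine (L2norme mu f))%:C.
Proof. exact: L2norm_class. Qed.

End L2space.

(** For [B] included in [A]: [B] is closed in the topology induced on [A]. *)
Definition closed_in (X : topologicalType) (A B : set X) : Prop :=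
  @closed (subspace A) B.

Definition lin_span (K : pzRingType) (V : lmodType K) (A : set V) : set V :=
  [set v | exists n (c : 'I_n -> K) (a : 'I_n -> V),
     (forall i, A (a i)) /\ v = \sum_(i < n) c i *: a i].

Section density.
Context d (T : measurableType d) (R : realType).
Variables (mu nu : {measure set T -> \bar R}) (w : T -> R).
Hypotheses (w0 : forall x, 0 <= w x) (mw : measurable_fun setT w).
Hypothesis nuE : forall A, measurable A -> nu A = (\int[mu]_(x in A) (w x)%:E)%E.

Import HBNNSimple.

Lemma ge0_integral_density (f : T -> \bar R) :
  (forall y, (0 <= f y)%E) -> measurable_fun setT f ->
  (\int[nu]_y f y = \int[mu]_y (f y * (w y)%:E))%E.
Proof.
move=> f0 mf; pose h := nnsfun_approx measurableT mf.
have mEw : measurable_fun setT (EFin \o w) by exact/measurable_EFinP.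
have -> : (\int[nu]_y f y =
    lim (\int[nu]_y (EFin \o h n) y @[n --> \oo]))%E.
  have fE y : f y = lim ((EFin \o h n) y @[n --> \oo]).
    by apply/esym/cvg_lim => //; exact: cvg_nnsfun_approx.
  under eq_integral => y _ do rewrite fE.
  apply: monotone_convergence => //.
  - by move=> n; exact/measurable_EFinP/measurable_funP.
  - by move=> n y _ //=; rewrite lee_fin.
  - by move=> y _ a b ab; rewrite lee_fin; exact/lefP/nd_nnsfun_approx.
have -> : (\int[mu]_y (f y * (w y)%:E) =
    lim (\int[mu]_y ((EFin \o h n) \* (EFin \o w)) y @[n --> \oo]))%E.
  have fg y : (f y * (w y)%:E =
      lim (((EFin \o h n) \* (EFin \o w)) y @[n --> \oo]))%E.
    apply/esym/cvg_lim => //; apply: cvgeZr => //.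
    exact: cvg_nnsfun_approx.
  under eq_integral => y _ do rewrite fg.
  apply: monotone_convergence => //.
  - by move=> n; apply: emeasurable_funM => //; exact/measurable_EFinP.
  - by move=> n y _ /=; rewrite mule_ge0 ?lee_fin ?w0.
  - move=> y _ a b ab/=; rewrite lee_wpmul2r ?lee_fin ?w0//.
    exact/lefP/nd_nnsfun_approx.
suff suf n : (\int[nu]_y (EFin \o h n) y =
    \int[mu]_y ((EFin \o h n) \* (EFin \o w)) y)%E.
  by under eq_fun do rewrite suf.
transitivity (\int[nu]_y
   (\sum_(r \in range (h n)) (r * \1_(h n @^-1` [set r]) y)%:E))%E.
  by apply: eq_integral => t tE; rewrite /= fimfunE -fsumEFin.
have indich r : measurable_fun setT (fun y : T => (r * \1_(h n @^-1` [set r]) y)%:E).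
  by apply/measurable_EFinP; exact: measurable_funM.
rewrite ge0_integral_fsum//; last by move=> m y Ey; exact: nnfun_muleindic_ge0.
transitivity (\int[mu]_y (\sum_(r \in range (h n))
    (r * \1_(h n @^-1` [set r]) y)%:E * (w y)%:E))%E; last first.
  under [RHS]eq_integral => y _.
    rewrite /= (fimfunE (h n) y) -fsumEFin// ge0_mule_fsuml => [|r]; last exact: nnfun_muleindic_ge0.
    over.
  by [].
rewrite ge0_integral_fsum//; last 2 first.
  - by move=> r; exact: emeasurable_funM.
  - move=> m y Ey; apply: mule_ge0; last by rewrite lee_fin.
    exact: nnfun_muleindic_ge0.
apply: eq_fsbigr => r rhn.
have r0 : 0 <= r by move: rhn; rewrite inE => -[t _ <-].
under eq_integral do rewrite EFinM.
rewrite integralZl_indic_nnsfun => //.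
under [RHS]eq_integral do rewrite EFinM -muleA.
rewrite ge0_integralZl//.
- rewrite integral_indic// setIT; congr (_ * _)%E.
  rewrite nuE// integral_mkcond; apply: eq_integral => y _.
  by rewrite epatch_indic muleC.
- by apply: emeasurable_funM => //; exact/measurable_EFinP.
- by move=> t Et; rewrite mule_ge0 ?lee_fin ?w0.
Qed.

End density.

Section weighted.
Context {R : realType}.
Implicit Types (t y : R) (f : R -> R[i]).

Local Notation leb := (@lebesgue_measure R).

Definition weight y : R := expR (- 2 * (expR y - 1)).

Definition wmeasure (A : set (measurableTypeR R)) : \bar R :=
  (\int[leb]_(y in A) (weight y)%:E)%E.

Lemma weight_ge0 y : 0 <= weight y.
Proof. exact: expR_ge0. Qed.

Lemma measurable_weight : measurable_fun [set: R] weight.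
Proof.
apply: measurableT_comp => //; apply: measurable_funM => //.
exact: measurable_funB.
Qed.

Let wmeasure0 : wmeasure set0 = 0%E.
Proof. exact: integral_set0. Qed.

Let wmeasure_ge0 A : (0 <= wmeasure A)%E.
Proof. by apply: integral_ge0 => y _; rewrite lee_fin weight_ge0. Qed.

Let wmeasure_sigma_additive : semi_sigma_additive wmeasure.
Proof.
move=> /= A mA tA mUA; rewrite /wmeasure ge0_integral_bigcup//=; last first.
- by move=> y _; rewrite lee_fin weight_ge0.
- by apply/measurable_EFinP; apply: measurable_funTS; exact: measurable_weight.
apply: is_cvg_ereal_nneg_natsum_cond => n _ _.
by apply: integral_ge0 => y _; rewrite lee_fin weight_ge0.
Qed.

HB.instance Definition _ := isMeasure.Build _ _ _
  wmeasure wmeasure0 wmeasure_ge0 wmeasure_sigma_additive.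

Lemma ge0_integral_wmeasure (f : R -> \bar R) :
  (forall y, (0 <= f y)%E) -> measurable_fun setT f ->
  (\int[wmeasure]_y f y = \int[leb]_y (f y * (weight y)%:E))%E.
Proof.
move=> f0 mf; apply: ge0_integral_density => //; first exact: weight_ge0.
exact: measurable_weight.
Qed.

Definition translate t (y : measurableTypeR R) : measurableTypeR R := y - t.

Lemma measurable_translate t : measurable_fun setT (translate t).
Proof. exact: measurable_funB. Qed.

HB.instance Definition _ t :=
  isMeasurableFun.Build _ _ _ _ (translate t) (measurable_translate t).

Lemma lebesgue_measure_translate t (A : set (measurableTypeR R)) :
  measurable A -> pushforward leb (translate t) A = leb A.
Proof.
move=> mA; apply/esym/lebesgue_measure_unique => //= _ [[a b]] _ <-.
rewrite /pushforward/= (_ : _ @^-1` _ = `]a + t, b + t]%classic).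
  rewrite !lebesgue_measure_itv/= !lte_fin ltrD2r.
  by case: ifPn => // _; rewrite -!EFinB opprD addrACA subrr addr0.
by apply/seteqP; split => y /=; rewrite !in_itv/= ltrBrDr lerBlDr.
Qed.

Lemma weight_nincr x y : x <= y -> weight y <= weight x.
Proof.
move=> xy; rewrite /weight ler_expR !mulNr lerN2 ler_pM2l//.
by rewrite lerB// ler_expR.
Qed.

Lemma wmeasure_translate t (A : set (measurableTypeR R)) : 0 <= t ->
  measurable A -> (wmeasure (translate t @^-1` A) <= wmeasure A)%E.
Proof.
move=> t0 mA.
have mpA : measurable (translate t @^-1` A).
  by rewrite -(setTI (_ @^-1` _)); exact: measurable_translate.
have mwt : measurable_fun setT (fun y : measurableTypeR R => (weight (y + t))%:E).
  apply/measurable_EFinP; apply: measurableT_comp; first exact: measurable_weight.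
  exact: measurable_funD.
rewrite /wmeasure.
have -> : (\int[leb]_(y in translate t @^-1` A) (weight y)%:E =
    \int[leb]_(y in A) (weight (y + t))%:E)%E.
  transitivity (\int[leb]_(y in translate t @^-1` A)
      ((fun x : measurableTypeR R => (weight (x + t))%:E) \o translate t) y)%E.
    by apply: eq_integral => y _ /=; rewrite /translate subrK.
  rewrite -ge0_integral_pushforward//.
  - by apply: eq_measure_integral => B mB _; exact: lebesgue_measure_translate.
  - exact: measurable_funTS.
  - by move=> y _; rewrite lee_fin weight_ge0.
apply: ge0_le_integral => //.
- by move=> y _; rewrite lee_fin weight_ge0.
- exact: measurable_funTS.
- by apply: measurable_funTS; apply/measurable_EFinP; exact: measurable_weight.
- by move=> y _; rewrite lee_fin weight_nincr// lerDl.
Qed.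

Lemma right_shift_is_L2fun t (f : L2fun wmeasure) : 0 <= t ->
  (f \o translate t) \in is_L2fun wmeasure.
Proof.
move=> t0; have [mr mi] := L2fun_measurable f.
have mc : cmeasurable (f \o translate t).
  by split; [apply: (measurableT_comp mr)|apply: (measurableT_comp mi)];
    exact: measurable_translate.
apply/is_L2funP; split => //.
apply: le_lt_trans (L2fun_finite f); rewrite /L2norme unlock /Lnorm.
apply: gt0_ler_poweR => //.
- by rewrite in_itv/= leey integral_ge0// => x _; exact: poweR_ge0.
- by rewrite in_itv/= leey integral_ge0// => x _; exact: poweR_ge0.
have mF : measurable_fun setT (fun x => `|(EFin \o cabs f) x| `^ 2)%E.
  apply: (measurableT_comp (measurable_poweR _)) => //.
  apply: measurableT_comp => //; apply/measurable_EFinP.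
  exact/measurable_cabs/L2fun_measurable.
rewrite [leLHS](_ : _ = \int[pushforward wmeasure (translate t)]_x
    (`|(EFin \o cabs f) x| `^ 2))%E; last first.
  rewrite ge0_integral_pushforward//.
  by move=> y _; exact: poweR_ge0.
apply: ge0_le_measure_integral => //.
- by move=> S mS; exact: wmeasure_translate.
- by move=> x; exact: poweR_ge0.
Qed.

Lemma measurable_neg_indic : cmeasurable (fun y : measurableTypeR R =>
  (\1_(`]-oo, 0[%classic : set R) y : R)%:C).
Proof. by split; [exact: measurable_indic|exact: measurable_cst]. Qed.

Lemma Pminus_is_L2fun (f : L2fun wmeasure) :
  (fun y => (\1_(`]-oo, 0[%classic : set R) y)%:C * f y) \in is_L2fun wmeasure.
Proof.
have mf := L2fun_measurable f.
have mPf := cmeasurableM measurable_neg_indic mf.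
apply/is_L2funP; split => //; apply: le_lt_trans (L2fun_finite f).
apply: Lnorm2_le; [exact: measurable_cabs|exact: measurable_cabs|].
move=> y; rewrite normc_ge0 /cabs normcM ler_piMl ?normc_ge0//.
rewrite -lecR -normcE normc_def/= expr0n addr0 sqrtr_sqr lecR.
by rewrite indicE; case: (_ \in _); rewrite ?normr1 ?normr0 ?ler01.
Qed.

Lemma exp_is_L2fun (l : R) : 0 < l ->
  (fun y => (expR (l * y))%:C) \in is_L2fun wmeasure.
Proof.
move=> l0; have mexp : measurable_fun setT (fun y : R => expR (l * y)).
  by apply: measurableT_comp => //; exact: measurable_funM.
apply/is_L2funP; split; first by split; [exact: mexp|exact: measurable_cst].
rewrite /L2norme unlock /Lnorm; apply: poweR_lty.
rewrite (eq_integral (fun y : measurableTypeR R => (expR (2 * l * y))%:E)); last first.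
  move=> y _; rewrite /= /cabs/= expr0n addr0 sqrtr_sqr normr_id.
  rewrite ger0_norm ?expR_ge0// -expRM.
  by congr (expR _)%:E; ring.
rewrite ge0_integral_wmeasure; last 2 first.
- by move=> y; rewrite lee_fin expR_ge0.
- apply/measurable_EFinP; apply: measurableT_comp => //; exact: measurable_funM.
pose K1 := expR ((2 * l + 1) ^+ 2).
pose K2 := expR 2 / (2 * l).
have l20 : 0 < 2 * l by rewrite mulr_gt0.
pose E1 := exponential_pdf (1 : R); pose E2 := exponential_pdf (2 * l).
have E10 y : 0 <= E1 y by apply: exponential_pdf_ge0.
have E20 y : 0 <= E2 y by apply: exponential_pdf_ge0; exact: ltW.
have mE1 : measurable_fun setT E1 by exact: measurable_exponential_pdf.
have mE2 : measurable_fun setT E2 by exact: measurable_exponential_pdf.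
have mE2N : measurable_fun setT (fun y : measurableTypeR R => (E2 (- y))%:E).
  apply/measurable_EFinP; apply: (measurableT_comp mE2).
  exact: measurable_funN.
have K10 : 0 <= K1 by exact: expR_ge0.
have K20 : 0 <= K2 by rewrite divr_ge0 ?expR_ge0// ltW.
apply: (@le_lt_trans _ _ (\int[leb]_y
    (K1%:E * (E1 y)%:E + K2%:E * (E2 (- y))%:E))%E).
  apply: ge0_le_integral => //.
  - by move=> y _; rewrite mule_ge0 ?lee_fin ?expR_ge0 ?weight_ge0.
  - apply: emeasurable_funM; apply/measurable_EFinP.
      by apply: measurableT_comp => //; exact: measurable_funM.
    exact: measurable_weight.
  - apply: emeasurable_funD; apply: emeasurable_funM => //.
    exact/measurable_EFinP.
  move=> y _; rewrite -EFinM -!EFinM -EFinD lee_fin.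
  have [y0|y0] := leP 0 y.
    apply: ler_wpDr; first by rewrite mulr_ge0.
    rewrite /E1 exponential_pdfE// mul1r /K1 /weight -!expRD ler_expR.
    have h : 1 + y ^+ 2 / 2 <= expR y by exact: (expR_ge1Dxn 1 y0).
    have h2 : 0 <= (2 * l + 1 - y / 2) ^+ 2 by exact: sqr_ge0.
    have h3 : 0 <= y ^+ 2 by exact: sqr_ge0.
    rewrite !expr2 in h h2 h3 *; lra.
  apply: ler_wpDl; first by rewrite mulr_ge0.
  rewrite /E2 exponential_pdfE ?oppr_ge0 ?ltW// /K2 mulrA divfK ?gt_eqF//.
  rewrite /weight -!expRD ltr_expR.
  have := expR_gt0 y; lra.
rewrite ge0_integralD//; last 4 first.
- by move=> y _; rewrite mule_ge0 ?lee_fin.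
- by apply: emeasurable_funM => //; exact/measurable_EFinP.
- by move=> y _; rewrite mule_ge0 ?lee_fin.
- exact: emeasurable_funM.
rewrite ge0_integralZl//; last 2 first.
- exact/measurable_EFinP.
- by move=> y _; rewrite lee_fin.
rewrite ge0_integralZl//; last by move=> y _; rewrite lee_fin.
rewrite integral_exponential_pdf//.
have -> : (\int[leb]_y (E2 (- y))%:E = 1)%E.
  rewrite -(integral_exponential_pdf l20).
  transitivity (\int[pushforward leb (-%R : _ -> measurableTypeR R)]_y (E2 y)%:E)%E.
    rewrite ge0_integral_pushforward//; last by move=> y _; rewrite lee_fin.
    exact/measurable_EFinP.
  by apply: eq_measure_integral => B mB _; exact: lebesgue_measureN.
by rewrite !mule1 -EFinD ltry.
Qed.

(** The operators below act on a representative of a class; [right_shiftE] and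
    [PminusE] show that its choice is irrelevant. *)

Local Notation L2w := (L2 wmeasure).

Definition right_shift_fun (t : {nonneg R}) (f : L2fun wmeasure) : L2fun wmeasure :=
  MkL2fun (right_shift_is_L2fun f (ge0 t)).

Definition right_shift (t : {nonneg R}) (u : L2w) : L2w :=
  L2class (right_shift_fun t (L2repr u)).

Definition Pminus_fun (f : L2fun wmeasure) : L2fun wmeasure :=
  MkL2fun (Pminus_is_L2fun f).

Definition Pminus (u : L2w) : L2w := L2class (Pminus_fun (L2repr u)).

Definition expo (l : {posnum R}) : L2w :=
  L2class (MkL2fun (exp_is_L2fun (gt0 l))).

Definition L2neg : set L2w :=
  [set u | {ae wmeasure, forall y : measurableTypeR R, 0 < y -> L2repr u y = 0}].

Lemma right_shiftE (t : {nonneg R}) (f : L2fun wmeasure) :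
  right_shift t (L2class f) = L2class (right_shift_fun t f).
Proof.
apply/L2class_eqP; have [A [mA A0 fA]] := L2classK f.
exists (translate t%:num @^-1` A); split.
- by rewrite -(setTI (_ @^-1` _)); exact: measurable_translate.
- apply/eqP; rewrite eq_le measure_ge0 andbT -A0.
  exact: wmeasure_translate.
- move=> y /= yA; apply: fA => /= h; apply: yA => _.
  exact: h.
Qed.

Lemma PminusE (f : L2fun wmeasure) :
  Pminus (L2class f) = L2class (Pminus_fun f).
Proof.
apply/L2class_eqP; apply: filterS (L2classK f) => y /= /(_ I) fy _.
by rewrite fy.
Qed.

Lemma Pminus_L2neg (u : L2w) : L2neg (Pminus u).
Proof.
apply: filterS (L2classK (Pminus_fun (L2repr u))) => y /(_ I) -> y0 /=.
by rewrite indicE memNset ?mul0r//= in_itv/=; apply/negP; rewrite -leNgt ltW.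
Qed.

End weighted.

Arguments L2neg : clear implicits.

(* Main.v *)
(** In the variable x = e^y the space N is the closed span of the powers x^(n^2)
    in a weighted L^2(0,+oo), and P_- is restriction to (0,1).  By Muentz, the
    n-th coefficient extends to a continuous functional on N, already with
    respect to the norm over a half-line (-oo, s): multiplying the coefficients
    by the Blaschke-type factors (l_i - l_m)/(l_i + l_m) does not increase the
    norm, and doing so for all m <> n kills every other coefficient at the price
    of a product that is at least e^(-14 n^2).  For s = 16 the growth of
    e^(n^2 s) wins, so the coefficients of an element of N are O(n e^(-2 n^2)).
    The sum of 2^(-n) e^(n^2 y) over n >= 1, restricted to y < 0, is a limit of
    elements of P_- N; an f in N restricting to it would have n-th coefficient
    2^(-n), as is seen with s = -1, and this is too large. *)

Require Import Defs.
From mathcomp Require Import all_boot all_order all_algebra.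
From mathcomp Require Import all_classical all_reals all_analysis.
From mathcomp Require Import measurable_realfun ring lra zify complex.

Set Implicit Arguments.
Unset Strict Implicit.
Unset Printing Implicit Defensive.

Import Order.TTheory GRing.Theory Num.Theory.
Import numFieldNormedType.Exports.
Import ComplexField.Normc.

Local Open Scope classical_set_scope.
Local Open Scope ring_scope.
Local Open Scope complex_scope.

(** * Gram form of exponentials *)

Section gram_form.
Variables (R : realFieldType) (l : nat -> R).
Hypothesis l_gt0 : forall i, 0 < l i.
Implicit Types (a : nat -> R) (K n m : nat) (s : seq nat).

(** The integral over (-oo, 0) of the square of the sum of a_i e^(l_i y), since e^((l_i + l_j) y)
    integrates to 1 / (l_i + l_j). *)
Definition gram K a : R :=
  \sum_(i < K) \sum_(j < K) a i * a j / (l i + l j).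

(** The Blaschke factor with zero l_m, evaluated at l_i; it vanishes for i = m. *)
Definition cayley i m : R := (l i - l m) / (l i + l m).

(** The loss is a rank-one square, because (l_i + l_m)(l_j + l_m) - (l_i - l_m)(l_j - l_m) = 2 l_m
    (l_i + l_j) cancels the denominator l_i + l_j. *)
Lemma gram_cayley_le m K a :
  gram K (fun i => a i * cayley i m) <= gram K a.
Proof.
rewrite -subr_ge0.
suff -> : gram K a - gram K (fun i => a i * cayley i m) =
    2 * l m * (\sum_(i < K) a i / (l i + l m)) ^+ 2.
  by rewrite mulr_ge0 ?sqr_ge0// mulr_ge0// ltW.
rewrite expr2 big_distrlr /= mulr_sumr -sumrB; apply: eq_bigr => i _.
rewrite mulr_sumr -sumrB; apply: eq_bigr => j _.
rewrite /cayley; field.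
by rewrite !gt_eqF ?addr_gt0.
Qed.

Lemma gram_prod_cayley_le s K a :
  gram K (fun i => a i * \prod_(m <- s) cayley i m) <= gram K a.
Proof.
elim: s a => [|m s IHs] a.
  by under eq_fun do rewrite big_nil mulr1.
under eq_fun do rewrite big_cons mulrA.
exact: le_trans (IHs _) (gram_cayley_le m K a).
Qed.

Lemma gram_single K (n : 'I_K) a : (forall i : 'I_K, i != n -> a i = 0) ->
  gram K a = a n * a n / (l n + l n).
Proof.
move=> a0; rewrite /gram (bigD1 n)//= [X in _ + X]big1 ?addr0 => [|i iNn].
  rewrite (bigD1 n)//= big1 ?addr0// => j jNn.
  by rewrite (a0 j)// mulr0 mul0r.
by rewrite big1// => j _; rewrite (a0 i)// !mul0r.
Qed.

Lemma gram_coef_le n K a : (n < K)%N ->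
  (a n * \prod_(m < K | m != n :> nat) cayley n m) ^+ 2 / (2 * l n) <= gram K a.
Proof.
move=> nK; pose s := [seq m <- index_iota 0 K | m != n].
apply: le_trans (gram_prod_cayley_le s K a).
(* For i other than n the product contains its own factor m = i, which is zero. *)
have prod0 (i : 'I_K) : i != Ordinal nK -> \prod_(m <- s) cayley i m = 0.
  move=> iNn; rewrite (bigD1_seq (nat_of_ord i))/= ?mem_filter ?mem_index_iota//=.
  - by rewrite /cayley subrr !mul0r.
  - by rewrite iNn ltn_ord.
  - by rewrite filter_uniq ?iota_uniq.
rewrite (gram_single (n := Ordinal nK)) => [|i iNn]; last by rewrite prod0// mulr0.
rewrite /s big_filter big_mkord.
by rewrite -expr2 -mulr2n mulr_natl.
Qed.

End gram_form.

(** * Lower bound for the Blaschke product at the squares *)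

Section square_exponents.
Variable R : realType.
Implicit Types (n m K : nat).

Definition sq_exponent n : R := n.+1%:R ^+ 2.

Lemma sq_exponent_gt0 n : 0 < sq_exponent n.
Proof. by rewrite exprn_gt0// ltr0n. Qed.

(** Majorant of -log of the modulus of the factor. With p = n + 1 and q = m + 1, the first term
    serves the near indices q < 2p, the second one the far indices q >= 2p. *)
Let s n m : R := (m < n.*2.+1)%:R * (3 * n.+1%:R) + 4 * n.+1%:R ^+ 2 / m.+1%:R ^+ 2.

Let expR_cayley_le n m : m != n ->
  expR (- s n m) <= `|cayley sq_exponent n m|.
Proof.
move=> mn; rewrite /cayley /sq_exponent normrM normfV.
set p : R := n.+1%:R; set q : R := m.+1%:R.
have p1 : 1 <= p by rewrite ler1n.
have q1 : 1 <= q by rewrite ler1n.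
have pq0 : 0 < p ^+ 2 + q ^+ 2 by rewrite addr_gt0// exprn_gt0//; lra.
rewrite [X in _ / X]ger0_norm ?(ltW pq0)// ler_pdivlMr//.
rewrite expRN mulrC ler_pdivrMr ?expR_gt0// /s -/p -/q.
have q0 : 4 * p ^+ 2 / q ^+ 2 >= 0.
  by rewrite divr_ge0 ?mulr_ge0 ?sqr_ge0.
(* Near indices: |p^2 - q^2| >= p + q as p and q are distinct integers, so the factor is at least 1
   / (p + q) >= 1 / (3 p) >= e^(-3 p). *)
have [mlt|mge] := ltnP m n.*2.+1.
  have q2p : q + p <= 3 * p.
    by rewrite /q /p -natrD -natrM ler_nat; lia.
  have e3 : 3 * p <= expR (1%:R * (3 * p) + 4 * p ^+ 2 / q ^+ 2).
    apply: le_trans (expR_ge1Dx _); move: q0; set e := _ / _ => q0; lra.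
  have d1 : 1 <= `|p - q|.
    rewrite /p /q; move: mn; rewrite neq_ltn => /orP[] h.
      by rewrite ger0_norm -?natrB ?ler0n ?ler1n//; lia.
    by rewrite distrC ger0_norm -?natrB ?ler0n ?ler1n//; lia.
  rewrite subr_sqr normrM (ger0_norm (x := p + q)); last lra.
  move: (expR _) e3 (`|_|) d1 => E e3 D d1.
  apply: (@le_trans _ _ ((p + q) * (p + q))); first by rewrite !expr2; nra.
  rewrite -[leLHS]mul1r mulrA; apply: ler_pM; [nra|lra| |lra].
  by rewrite mul1r -[leLHS]mul1r; apply: ler_wpM2r; lra.
(* Far indices: with P = p^2, Q = q^2 and Q >= 4 P, already (Q - P)(1 + 4 P / Q) >= Q + P, and 1 + x
   <= e^x. *)
have q2p : 2 * p <= q by rewrite /q /p -natrM ler_nat; lia.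
rewrite mul0r add0r.
have qq : 4 * p ^+ 2 <= q ^+ 2 by rewrite !expr2; nra.
have p20 : 0 < p ^+ 2 by rewrite exprn_gt0//; lra.
have q20 : 0 < q ^+ 2 by rewrite exprn_gt0//; lra.
rewrite distrC ger0_norm; last lra.
apply: (@le_trans _ _ ((q ^+ 2 - p ^+ 2) * (1 + 4 * p ^+ 2 / q ^+ 2))); last first.
  by apply: ler_wpM2l (expR_ge1Dx _); lra.
move: (p ^+ 2) (q ^+ 2) p20 q20 qq => P Q P0 Q0 PQ.
rewrite -(ler_pM2r Q0) (_ : _ * _ * Q = (Q - P) * (Q + 4 * P)); first by nra.
by field; rewrite gt_eqF.
Qed.

Let sum_inv_sq K : \sum_(m < K) m.+1%:R ^- 2 <= 2 :> R.
Proof.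
case: K => [|K]; first by rewrite big_ord0.
(* The sharper bound is what the induction carries, by comparison with a telescoping sum. *)
suff : \sum_(m < K.+1) m.+1%:R ^- 2 <= 2 - K.+1%:R^-1 :> R.
  by move/le_trans; apply; rewrite gerBl invr_ge0.
elim: K => [|K IH]; first by rewrite big_ord_recr big_ord0/= invr1; lra.
rewrite big_ord_recr/=; apply: le_trans (lerD IH (lexx _)) _.
rewrite -subr_ge0 -(natr1 K.+1).
have K0 : 0 < K.+1%:R :> R by rewrite ltr0n.
move: (K.+1%:R : R) K0 => k k0.
suff -> : 2 - (k + 1)^-1 - (2 - k^-1 + (k + 1) ^- 2) = k^-1 / (k + 1) ^+ 2.
  by rewrite divr_ge0 ?sqr_ge0// invr_ge0 ltW.
by field; rewrite !gt_eqF//; lra.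
Qed.

Lemma prod_cayley_ge n K : expR (- (14 * sq_exponent n)) <=
  `|\prod_(m < K | m != n :> nat) cayley sq_exponent n m|.
Proof.
rewrite normr_prod.
apply: (@le_trans _ _ (\prod_(m < K | m != n :> nat) expR (- s n m))); last first.
  by apply: ler_prod => m mn; rewrite expR_ge0/= expR_cayley_le.
rewrite -expR_sum ler_expR sumrN lerN2.
have s0 m : 0 <= s n m by rewrite addr_ge0 ?mulr_ge0 ?invr_ge0 ?sqr_ge0.
(* Restoring the term m = n only enlarges the sum. At most 2 p near indices cost 3 p each, the far
   terms cost at most 4 p^2 times 2; hence 14 = 6 + 8. *)
apply: (@le_trans _ _ (\sum_(m < K) s n m)).
  by rewrite [leRHS](bigID (fun m : 'I_K => m != n :> nat))/= lerDl sumr_ge0.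
rewrite big_split/= -mulr_suml -mulr_sumr /sq_exponent.
have p1 : 1 <= n.+1%:R :> R by rewrite ler1n.
have h1 : \sum_(m < K) (m < n.*2.+1)%:R <= 2 * n.+1%:R :> R.
  rewrite -natr_sum -natrM ler_nat.
  apply: (@leq_trans n.*2.+1); last lia.
  suff -> : (\sum_(m < K) (m < n.*2.+1) = minn K n.*2.+1)%N by exact: geq_minr.
  by elim: K => [|K IH]; rewrite ?big_ord0 ?min0n// big_ord_recr /= IH; lia.
have h2 := sum_inv_sq K.
rewrite !expr2; set A := (\sum_(m < K) _) in h1 *; set B := (\sum_(m < K) _) in h2 *.
move: (n.+1%:R : R) p1 h1 => p p1 h1.
have : A * (3 * p) <= 2 * p * (3 * p) by apply: ler_wpM2r => //; lra.
have : 4 * (p * p) * B <= 4 * (p * p) * 2 by apply: ler_wpM2l => //; nra.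
by lra.
Qed.

End square_exponents.

(** * Weighted integrals of exponential sums *)

Lemma cvg_sum (R : realType) (T : Type) (F : set_system T) (FF : Filter F)
    (K : nat) (f : 'I_K -> T -> R) (c : 'I_K -> R) :
  (forall i, f i x @[x --> F] --> c i) ->
  \sum_(i < K) f i x @[x --> F] --> \sum_(i < K) c i.
Proof.
move=> fc; apply: (@cvg_big _ _ +%R 0 xpredT) => [z|i _]; last exact: fc.
exact: add_continuous.
Qed.

Section exp_sums.
Variables (R : realType) (l : nat -> R).
Hypothesis l_gt0 : forall i, 0 < l i.
Implicit Types (a : nat -> R) (K : nat) (s y : R).
Local Notation leb := (@lebesgue_measure R).

Definition exp_sum K a y : R := \sum_(i < K) a i * expR (l i * y).

(** The antiderivative of [exp_sum K a] squared that tends to 0 at -oo. *)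
Let primitive K a y : R := gram l K (fun i => a i * expR (l i * y)).

Let is_derive_expRM (c y : R) : is_derive y 1 (fun z : R => expR (c * z)) (c * expR (c * y)).
Proof.
have h : is_derive y 1 (fun z : R => c * z) c.
  by have := is_deriveZ c (is_derive_id y (1 : R)); rewrite /GRing.scale/= mulr1.
have := @is_derive1_comp R expR (fun z => c * z) y (expR (c * y)) c (is_derive_expR _) h.
by rewrite mulrC.
Qed.

Let is_derive_primitive K a y :
  is_derive y 1 (primitive K a) (exp_sum K a y ^+ 2).
Proof.
have -> : primitive K a = \sum_(i < K) \sum_(j < K)
    ((a i * a j / (l i + l j)) *: (fun z : R => expR ((l i + l j) * z))).
  apply/funext => z; rewrite fct_sumE; apply: eq_bigr => i _.
  rewrite fct_sumE; apply: eq_bigr => j _.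
  rewrite -[RHS]/(_ * _) mulrDl expRD.
  by field; rewrite gt_eqF ?addr_gt0.
have -> : exp_sum K a y ^+ 2 = \sum_(i < K) \sum_(j < K)
    ((a i * a j / (l i + l j)) *: ((l i + l j) * expR ((l i + l j) * y))).
  rewrite expr2 big_distrlr/=; apply: eq_bigr => i _; apply: eq_bigr => j _.
  rewrite -[RHS]/(_ * _) (mulrDl (l i) (l j) y) expRD.
  by field; rewrite gt_eqF ?addr_gt0.
apply: is_derive_sum => i; apply: is_derive_sum => j.
exact: is_deriveZ.
Qed.

Let continuous_exp_sum K a : continuous (exp_sum K a).
Proof.
move=> y; apply: cvg_sum => i; apply: cvgMr.
apply: (@continuous_comp _ _ _ (fun z => l i * z) expR); last exact: continuous_expR.
exact: mulrl_continuous.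
Qed.

Let primitive_cvg0 K a s : primitive K a (s - n%:R) @[n --> \oo] --> 0.
Proof.
rewrite (_ : 0 = \sum_(i < K) \sum_(j < K) (0 : R)); last first.
  by rewrite big1// => i _; rewrite big1.
apply: cvg_sum => i; apply: cvg_sum => j.
pose c := a i * expR (l i * s) * (a j * expR (l j * s)) / (l i + l j).
(* Each term is geometric in n, of ratio e^(-(l_i + l_j)) < 1. *)
rewrite (_ : (fun _ => _) = fun n => c * (expR (- (l i + l j))) ^+ n).
  rewrite -(mulr0 c); apply: cvgMr; apply: cvg_expr.
  by rewrite ger0_norm ?expR_ge0// -expR0 ltr_expR oppr_lt0 addr_gt0.
apply/funext => n; rewrite /c -expRM_natr !mulrBr !mulNr mulrDl opprD !expRD.
by ring.
Qed.

(** The weight is nonincreasing, hence at least [weight s] on (-oo, s], where the Gram form is the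
    unweighted integral of the squared sum. Only the values of [g] below s are compared. *)
Lemma gram_le_integral (g : R -> R) K a s : measurable_fun setT g ->
  (forall y, 0 <= g y) -> (forall y, y <= s -> exp_sum K a y ^+ 2 <= g y) ->
  ((weight s * gram l K (fun i => a i * expR (l i * s)))%:E <=
   \int[@wmeasure R]_y (g y)%:E)%E.
Proof.
move=> mg g0 ag; have mg' : measurable_fun setT (EFin \o g) by exact/measurable_EFinP.
have mw : measurable_fun setT (EFin \o @weight R).
  by apply/measurable_EFinP; exact: measurable_weight.
rewrite ge0_integral_wmeasure//.
(* The fundamental theorem of calculus is applied on [s - (n + 1), s], nondegenerate for every n;
   then n tends to infinity. *)
have le_n n : ((weight s * (primitive K a s - primitive K a (s - n.+1%:R)))%:E <=
    \int[leb]_y ((g y)%:E * (weight y)%:E))%E.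
  have sn : s - n.+1%:R < s by rewrite ltrBlDr ltrDl ltr0n.
  have dP (y : R) : derivable (primitive K a) y 1 by exact: ex_derive.
  have cP : continuous (primitive K a).
    by move=> y; apply/differentiable_continuous/derivable1_diffP.
  have cf : continuous (fun y => exp_sum K a y ^+ 2).
    move=> y; apply: (@continuous_comp _ _ _ (exp_sum K a) (fun x => x ^+ 2)).
      exact: continuous_exp_sum.
    exact: exprn_continuous.
  have mf : measurable_fun setT (fun y => exp_sum K a y ^+ 2).
    exact: continuous_measurable_fun.
  have := @continuous_FTC2 R (fun y => exp_sum K a y ^+ 2) (primitive K a) _ _ sn.
  move=> /(_ _ _ _) FTC; rewrite EFinM EFinB -FTC; first last.
  - by move=> y _; rewrite derive1E; exact: derive_val.
  - by split=> //; apply: cvg_within_filter; exact: cP.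
  - exact: continuous_subspaceT.
  rewrite -ge0_integralZl//; last 3 first.
  - by apply/measurable_EFinP; exact: measurable_funTS.
  - by move=> y _; rewrite lee_fin sqr_ge0.
  - by rewrite lee_fin weight_ge0.
  apply: (@le_trans _ _ (\int[leb]_(y in `[(s - n.+1%:R)%R, s]) ((g y)%:E * (weight y)%:E))%E).
    apply: ge0_le_integral => //.
    - by move=> y _; rewrite mule_ge0// lee_fin ?weight_ge0 ?sqr_ge0.
    - apply: emeasurable_funM => //.
      by apply/measurable_EFinP; exact: measurable_funTS.
    - by apply: emeasurable_funM; exact: measurable_funTS.
    move=> y; rewrite /= in_itv/= => /andP[_ ys].
    rewrite -!EFinM lee_fin mulrC; apply: ler_pM; rewrite ?sqr_ge0 ?weight_ge0//.
      exact: ag.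
    exact: weight_nincr.
  apply: ge0_subset_integral => //.
  - exact: emeasurable_funM.
  - by move=> y _; rewrite mule_ge0// lee_fin ?weight_ge0.
case: (\int[_]_y _)%E le_n => [r| |] le_n; last 2 first.
- by rewrite leey.
- by have := le_n 0%N; rewrite leeNy_eq.
rewrite lee_fin.
have cv : weight s * (primitive K a s - primitive K a (s - n.+1%:R)) @[n --> \oo] -->
    weight s * (primitive K a s - 0).
  apply: cvgMr; apply: cvgB; first exact: cvg_cst.
  by have := @primitive_cvg0 K a s; rewrite -(cvg_shiftn 1); under eq_fun do rewrite addn1.
rewrite subr0 in cv; rewrite -[leLHS](cvg_lim _ cv)//.
apply: limr_le; first by apply/cvg_ex; eexists; exact: cv.
by near=> n; rewrite -lee_fin.
Unshelve. all: by end_near. Qed.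

End exp_sums.

(** * Norm and closures *)

Lemma normc_sqr (R : rcfType) (z : R[i]) :
  normc z ^+ 2 = complex.Re z ^+ 2 + complex.Im z ^+ 2.
Proof. by case: z => x y /=; rewrite sqr_sqrtr// addr_ge0 ?sqr_ge0. Qed.

Section L2real_norm.
Context d (T : measurableType d) (R : realType) (mu : {measure set T -> \bar R}).
Implicit Types (f g : L2fun mu) (u v : L2 mu).

Definition L2rnorm u : R := fine (L2norme mu (L2repr u)).

Lemma L2rnormE u : `|u| = (L2rnorm u)%:C.
Proof. by []. Qed.

Lemma L2rnorm_class f : L2rnorm (L2class f) = fine (L2norme mu f).
Proof. by rewrite /L2rnorm (L2norme_ae (L2classK f)). Qed.

Lemma L2rnorm_ge0 u : 0 <= L2rnorm u.
Proof. exact/fine_ge0/L2norme_ge0. Qed.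

Lemma ler_L2rnormD u v : L2rnorm (u + v) <= L2rnorm u + L2rnorm v.
Proof. by rewrite -lecR rmorphD -!L2rnormE ler_normD. Qed.

Lemma L2rnormBC u v : L2rnorm (u - v) = L2rnorm (v - u).
Proof.
by have := distrC u v; rewrite !L2rnormE => /(congr1 (@complex.Re R)).
Qed.

Lemma integral_normc_sqr f :
  (\int[mu]_y (normc (f y) ^+ 2)%:E = (L2rnorm (L2class f) ^+ 2)%:E)%E.
Proof.
rewrite L2rnorm_class -powR_mulrn ?fine_ge0 ?L2norme_ge0// -poweR_EFin.
rewrite L2norme_fineK /L2norme unlock /Lnorm -poweRrM mulVf// poweRe1; last first.
  by apply: integral_ge0 => y _; exact: poweR_ge0.
apply: eq_integral => y _ /=.
by rewrite ger0_norm ?normc_ge0// powR_mulrn ?normc_ge0.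
Qed.

Lemma closure_L2P (A : set (L2 mu)) u :
  closure A u <-> forall e : R, 0 < e -> exists2 v, A v & L2rnorm (u - v) < e.
Proof.
split=> [Au e e0|H B /nbhs_ballP[e /= e0 eB]].
  have [] := Au (ball u e%:C); first by apply: nbhsx_ballx; rewrite ltcR.
  move=> v [Av]; rewrite -ball_normE/= L2rnormE ltcR => uv.
  by exists v.
(* The radius lives in [R[i]]; positivity there forces its imaginary part to be 0. *)
move: e e0 eB => [e e'] e0 eB; move: e0; rewrite ltcE/= => /andP[/eqP e'0 e0].
rewrite {}e'0 in eB.
have [v Av uv] := H e e0.
exists v; split => //; apply: eB; rewrite -ball_normE/= L2rnormE.
by rewrite -[X in _ < X]/(e%:C) ltcR.
Qed.

End L2real_norm.

(** * Closures of subspaces in a normed module *)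

Section closure_linear.
Variables (K : numFieldType) (V : normedModType K).
Implicit Types A : set V.

Lemma lin_span_submod A : GRing.submod_closed (mem (lin_span A)).
Proof.
split=> [|a u v]; rewrite !inE.
  by exists 0%N, (fun _ => 0), (fun _ => 0); split => [[]//|]; rewrite big_ord0.
move=> [n [c [x [xA ->]]]] [m [c' [x' [xA' ->]]]].
exists (n + m)%N,
  (fun i => match fintype.split i with inl j => a * c j | inr j => c' j end),
  (fun i => match fintype.split i with inl j => x j | inr j => x' j end).
split; first by move=> i; case: fintype.split.
rewrite big_split_ord/= scaler_sumr; congr (_ + _); apply: eq_bigr => i _.
  by rewrite -[lshift m i]/(unsplit (inl i)) unsplitK scalerA.
by rewrite -[rshift n i]/(unsplit (inr i)) unsplitK.
Qed.

Lemma closure_submod A : GRing.submod_closed (mem A) ->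
  GRing.submod_closed (mem (closure A)).
Proof.
move=> [A0 AD]; split=> [|a u v]; rewrite !inE in A0 *.
  exact: subset_closure.
move=> Au Av B aB.
have /(_ B aB) : ((fun z : V * V => a *: z.1 + z.2) @ (u, v) --> a *: u + v).
  by apply: cvgD; [apply: (@cvgZ _ _ _ _ _ (fun=> a)); [exact: cvg_cst|]; apply: cvg_fst|apply: cvg_snd].
move=> [[P Q]/= [uP vQ] PQ].
have [x [Ax Px]] := Au P uP; have [y [Ay Qy]] := Av Q vQ.
exists (a *: x + y); split; last exact: (PQ (x, y)).
by have := AD a x y; rewrite !inE; apply.
Qed.

Lemma closure_image_sub A (f : V -> V) : (forall u v, `|f u - f v| <= `|u - v|) ->
  f @` A `<=` A -> f @` closure A `<=` closure A.
Proof.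
move=> f1 fA _ [u Au <-] B fuB.
have [] := Au (f @^-1` B).
  have /(_ B fuB) // : f @ u --> f u.
  apply/cvgrPdist_lt => e e0; near=> v; apply: le_lt_trans (f1 u v) _.
  by near: v; exact: cvgr_dist_lt.
by move=> v [Av Bfv]; exists (f v); split => //; apply: fA; exists v.
Unshelve. all: by end_near. Qed.

End closure_linear.

(** * Coefficient functionals *)

Section square_exponentials.
Variable R : realType.
Local Notation wm := (@wmeasure R).
Local Notation lam := (sq_exponent R).
Local Notation L2w := (L2 wm).
Implicit Types (K n m : nat) (c : nat -> R[i]) (u v : L2w) (f g : L2fun wm).

Definition sq_exp n : L2fun wm := MkL2fun (exp_is_L2fun (sq_exponent_gt0 R n)).

Definition sq_exp_sum K c : L2fun wm := \sum_(m < K) c m *: sq_exp m.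

Lemma expo_sqE n : expo (n.+1%:R ^+ 2)%:pos = L2class (sq_exp n).
Proof. by congr L2class; exact: val_inj. Qed.

Lemma sq_exp_sumE K c y :
  sq_exp_sum K c y = \sum_(m < K) c m * (expR (lam m * y))%:C.
Proof.
rewrite /sq_exp_sum; elim: K => [|K IH]; first by rewrite !big_ord0.
by rewrite !big_ord_recr/= -IH.
Qed.

Lemma L2class_sum (I : Type) (s : seq I) (P : pred I) (h : I -> L2fun wm) :
  L2class (\sum_(i <- s | P i) h i) = \sum_(i <- s | P i) L2class (h i).
Proof. exact: (big_morph _ (@L2classD _ _ _ wm) (raddf0 _)). Qed.

Lemma L2class_sq_exp_sum K c :
  L2class (sq_exp_sum K c) = \sum_(m < K) c m *: L2class (sq_exp m).
Proof. by rewrite /sq_exp_sum L2class_sum; apply: eq_bigr => m _; exact: L2classZ. Qed.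

Definition sq_span : set L2w :=
  lin_span (range (fun n : nat => expo (n.+1%:R ^+ 2)%:pos)).

(** A normal form with one coefficient per exponent, so that the coefficient estimates apply:
    repeated generators are grouped by index. *)
Lemma sq_spanP u : sq_span u <-> exists K c, u = L2class (sq_exp_sum K c).
Proof.
split=> [[n [a [x [xE ->]]]]|[K [c ->]]]; last first.
  exists K, (fun i => c i), (fun i => expo (i.+1%:R ^+ 2)%:pos); split.
    by move=> i; exists i.
  by rewrite L2class_sq_exp_sum; apply: eq_bigr => m _; rewrite expo_sqE.
have {}xE i : exists k, x i = L2class (sq_exp k).
  by have [k _ <-] := xE i; exists k; rewrite expo_sqE.
have [k kE] := choice xE.
pose K := (\max_(i < n) k i).+1.
have kK i : (k i < K)%N by rewrite ltnS leq_bigmax.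
exists K, (fun m => \sum_(i < n | k i == m) a i).
rewrite L2class_sq_exp_sum (partition_big (fun i => Ordinal (kK i)) xpredT)//=.
apply: eq_bigr => m _; rewrite scaler_suml; apply: eq_big => // i /eqP <-.
by rewrite kE.
Qed.

(** Bound for the square of the n-th coefficient functional on (-oo, s): 28 is twice the 14 of the
    Blaschke product, -2 s comes from translating by s, 4 is the 2 of the single Gram term doubled
    for real and imaginary parts. *)
Definition coef_bound n s : R := 4 * lam n * expR ((28 - 2 * s) * lam n) / weight s.

Lemma coef_bound_ge0 n s : 0 <= coef_bound n s.
Proof.
rewrite divr_ge0 ?weight_ge0// mulr_ge0 ?expR_ge0// mulr_ge0//.
exact/ltW/sq_exponent_gt0.
Qed.

Lemma real_coef_le (a : nat -> R) K n s : (n < K)%N ->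
  a n ^+ 2 <= 2 * lam n * expR ((28 - 2 * s) * lam n) *
              gram lam K (fun i => a i * expR (lam i * s)).
Proof.
move=> nK.
have := gram_coef_le (sq_exponent_gt0 R) (fun i => a i * expR (lam i * s)) nK.
have := prod_cayley_ge R n K; set P := (\prod_(m < K | _) _).
rewrite ler_pdivrMr ?mulr_gt0 ?sq_exponent_gt0// => hP.
move: (gram _ _ _) => G hG.
have P2 : expR (- (28 * lam n)) <= P ^+ 2.
  rewrite -real_normK ?num_real// (_ : - (28 * lam n) = - (14 * lam n) * 2%:R); last by ring.
  by rewrite expRM_natr ler_sqr ?nnegrE ?expR_ge0.
have h : a n ^+ 2 * expR (2 * s * lam n) * expR (- (28 * lam n)) <= G * (2 * lam n).
  apply: le_trans hG; rewrite !exprMn -expRM_natr (_ : 2 * s * _ = lam n * s * 2%:R); last by ring.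
  by apply: ler_wpM2l => //; rewrite mulr_ge0 ?sqr_ge0 ?expR_ge0.
have e0 := expR_ge0 ((28 - 2 * s) * lam n).
have {h} := ler_wpM2r e0 h.
have -> (x y z w : R) : x * expR y * expR z * expR w = x * expR (y + z + w).
  by rewrite !expRD; ring.
rewrite (_ : _ + _ + _ = 0) ?expR0 ?mulr1; last by ring.
by move=> /le_trans; apply; rewrite le_eqVlt; apply/orP; left; apply/eqP; ring.
Qed.

Lemma coef_le f K c n s : (n < K)%N ->
  (forall y, y <= s -> f y = sq_exp_sum K c y) ->
  normc (c n) ^+ 2 <= coef_bound n s * L2rnorm (L2class f) ^+ 2.
Proof.
move=> nK fE.
(* Stated for an abstract [part] so as to serve for the real and the imaginary part alike; the Gram
   form is real. *)
have key (part : {additive R[i] -> R}) :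
    (forall z (r : R), part (z * r%:C) = part z * r) ->
    (forall z, part z ^+ 2 <= normc z ^+ 2) ->
    weight s * gram lam K (fun i => part (c i) * expR (lam i * s)) <=
      L2rnorm (L2class f) ^+ 2.
  move=> partM part_le; rewrite -lee_fin -integral_normc_sqr.
  apply: (gram_le_integral (sq_exponent_gt0 R) (a := fun i => part (c i))).
  - apply: measurable_funX; exact: (measurable_cabs (L2fun_measurable f)).
  - by move=> y; exact: sqr_ge0.
  - move=> y ys; rewrite fE//; apply: le_trans (part_le _).
    rewrite sq_exp_sumE raddf_sum /exp_sum.
    by under [in leRHS]eq_bigr do rewrite partM.
have {}key (part : {additive R[i] -> R}) :
    (forall z (r : R), part (z * r%:C) = part z * r) ->
    (forall z, part z ^+ 2 <= normc z ^+ 2) ->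
    part (c n) ^+ 2 <= coef_bound n s * L2rnorm (L2class f) ^+ 2 / 2.
  move=> partM part_le; have := key part partM part_le.
  have := real_coef_le (fun i => part (c i)) s nK.
  have w0 : 0 < weight s :> R by exact: expR_gt0.
  move: (gram _ _ _) => G /= hG; rewrite -ler_pdivlMl// => hN.
  apply: le_trans hG _; apply: le_trans (ler_wpM2l _ hN) _.
    by rewrite mulr_ge0 ?expR_ge0// mulr_ge0// ltW// sq_exponent_gt0.
  by rewrite le_eqVlt; apply/orP; left; apply/eqP; rewrite /coef_bound; field; rewrite gt_eqF.
rewrite normc_sqr [leRHS]splitr; apply: lerD.
  apply: (key (@complex.Re R)) => [[a b] r /=|z]; first by ring.
  by rewrite normc_sqr lerDl sqr_ge0.
apply: (key (@complex.Im R)) => [[a b] r /=|z]; first by ring.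
by rewrite normc_sqr lerDr sqr_ge0.
Qed.

End square_exponentials.

(** * Contractivity of the shifts and of the projection *)

Section operators.
Variable R : realType.
Local Notation wm := (@wmeasure R).
Local Notation lam := (sq_exponent R).
Local Notation L2w := (L2 wm).
Implicit Types (K n m : nat) (c : nat -> R[i]) (u v : L2w) (f g : L2fun wm) (t : {nonneg R}).

Lemma L2classB f g : L2class (f - g) = L2class f - L2class g.
Proof. exact: raddfB. Qed.

Lemma L2rnorm_class_le f g : (forall y, normc (f y) <= normc (g y)) ->
  L2rnorm (L2class f) <= L2rnorm (L2class g).
Proof.
move=> fg; rewrite !L2rnorm_class -lee_fin !L2norme_fineK.
apply: Lnorm2_le => [||y].
- exact: (measurable_cabs (L2fun_measurable f)).
- exact: (measurable_cabs (L2fun_measurable g)).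
- by rewrite normc_ge0 fg.
Qed.

Lemma Pminus_funB f g : Pminus_fun (f - g) = Pminus_fun f - Pminus_fun g.
Proof.
apply: val_inj; apply/funext => y /=.
by rewrite -[LHS]/(_ * (f y - g y)) mulrBr.
Qed.

Lemma PminusB u v : Pminus (u - v) = Pminus u - Pminus v.
Proof.
by rewrite -[u]L2reprK -[v]L2reprK -L2classB !PminusE Pminus_funB L2classB.
Qed.

Lemma L2rnorm_Pminus_le u : L2rnorm (Pminus u) <= L2rnorm u.
Proof.
rewrite -[u]L2reprK PminusE; apply: L2rnorm_class_le => y /=.
rewrite normcM ler_piMl ?normc_ge0//= expr0n addr0 sqrtr_sqr indicE.
by case: (_ \in _); rewrite ?normr1 ?normr0 ?ler01.
Qed.

Lemma right_shift_funB t f g :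
  right_shift_fun t (f - g) = right_shift_fun t f - right_shift_fun t g.
Proof. exact: val_inj. Qed.

Lemma right_shiftB t u v :
  right_shift t (u - v) = right_shift t u - right_shift t v.
Proof.
rewrite -[u]L2reprK -[v]L2reprK -L2classB !right_shiftE.
by rewrite right_shift_funB L2classB.
Qed.

Lemma L2rnorm_right_shift_le t u : L2rnorm (right_shift t u) <= L2rnorm u.
Proof.
rewrite -[u]L2reprK right_shiftE; move: (L2repr u) => {u}f.
rewrite -ler_sqr ?nnegrE ?L2rnorm_ge0// -lee_fin -!integral_normc_sqr.
have mf : measurable_fun setT (fun y => (normc (f y) ^+ 2)%:E).
  apply/measurable_EFinP; apply: measurable_funX.
  exact: (measurable_cabs (L2fun_measurable f)).
(* Integrating a shifted function amounts to integrating against the translated measure, which is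
   dominated by [wm]. *)
rewrite [leLHS](_ : _ = \int[pushforward wm (translate t%:num)]_y
    (normc (f y) ^+ 2)%:E)%E; last first.
  by rewrite ge0_integral_pushforward// => y _; rewrite lee_fin sqr_ge0.
apply: ge0_le_measure_integral => // [S mS|y].
  exact: wmeasure_translate.
by rewrite lee_fin sqr_ge0.
Qed.

(** Exponentials are eigenvectors: S_t maps e_l to e^(-l t) e_l. *)
Lemma right_shift_sq_span t : right_shift t @` @sq_span R `<=` @sq_span R.
Proof.
move=> _ [_ /sq_spanP[K [c ->]] <-]; apply/sq_spanP.
exists K, (fun m => c m * (expR (- (lam m * t%:num)))%:C).
rewrite right_shiftE; congr L2class; apply: val_inj; apply/funext => y /=.
rewrite /translate !sq_exp_sumE; apply: eq_bigr => m _.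
by rewrite -mulrA -rmorphM -expRD mulrBr addrC.
Qed.

Lemma sq_exp_sum_widen K L c : (K <= L)%N ->
  sq_exp_sum K c = sq_exp_sum L (fun m => if (m < K)%N then c m else 0).
Proof.
move=> KL; rewrite /sq_exp_sum.
rewrite (big_ord_widen _ (fun m => c m *: sq_exp R m) KL) big_mkcond.
by apply: eq_bigr => m _; case: ifP => // _; rewrite scale0r.
Qed.

Lemma sq_exp_sumB K c c' :
  sq_exp_sum K c - sq_exp_sum K c' = sq_exp_sum K (fun m => c m - c' m).
Proof. by rewrite /sq_exp_sum -sumrB; apply: eq_bigr => m _; rewrite scalerBl. Qed.

Lemma coef_norm_le f K c n (s : R) : (n < K)%N ->
  (forall y, y <= s -> f y = sq_exp_sum K c y) ->
  normc (c n) <= Num.sqrt (coef_bound n s) * L2rnorm (L2class f).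
Proof.
move=> nK fE; rewrite -ler_sqr ?nnegrE ?normc_ge0 ?mulr_ge0 ?L2rnorm_ge0//.
by rewrite exprMn sqr_sqrtr ?coef_bound_ge0//; exact: coef_le fE.
Qed.

(** The threshold is strictly negative because the indicator of (-oo, 0) vanishes at 0, whereas the
    coefficient bounds use a closed half-line. *)
Lemma Pminus_fun_below f y : y <= -1 -> Pminus_fun f y = f y.
Proof.
move=> y1; rewrite /= indicE mem_set ?mul1r//= in_itv/=.
by rewrite (le_lt_trans y1)// ltrN10.
Qed.

End operators.

(** * The lacunary series *)

Section lacunary_series.
Variable R : realType.
Local Notation wm := (@wmeasure R).
Local Notation lam := (sq_exponent R).
Local Notation L2w := (L2 wm).
Implicit Types (K n m : nat) (y : R).

Let neg y : R := \1_(`]-oo, 0[%classic : set R) y.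

Let negP y : (y < 0 /\ neg y = 1) \/ (0 <= y /\ neg y = 0).
Proof.
rewrite /neg indicE; have [y0|y0] := ltP y 0; [left|right]; split=> //.
  by rewrite mem_set//= in_itv/= y0.
by rewrite memNset//= in_itv/=; apply/negP; rewrite -leNgt.
Qed.

Definition lacunary_partial K y : R :=
  neg y * \sum_(m < K) 2^-1 ^+ m.+1 * expR (lam m * y).

(** For y < 0 every e^(n^2 y) is at most e^y, so the tail after K terms is at most 2^(-K) e^y. These
    majorants decrease in K and enclose the limit from above. *)
Let upper K y : R := lacunary_partial K y + neg y * (2^-1 ^+ K * expR y).

Let lacunary_partial_nd y : nondecreasing_seq (lacunary_partial ^~ y).
Proof.
apply/nondecreasing_seqP => K; rewrite /lacunary_partial big_ord_recr/= mulrDr lerDl.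
by case: (negP y) => -[_ ->]; rewrite ?mul0r// mul1r mulr_ge0 ?expR_ge0 ?exprn_ge0.
Qed.

Let upper_ni y : nonincreasing_seq (upper ^~ y).
Proof.
apply/nonincreasing_seqP => K; rewrite /upper /lacunary_partial.
case: (negP y) => -[y0 ->]; last by rewrite !mul0r.
rewrite big_ord_recr/= !mul1r -addrA lerD2l exprS.
have e2 : 0 <= 2^-1 ^+ K :> R by rewrite exprn_ge0.
have : expR (lam K * y) <= expR y.
  rewrite ler_expR -[leRHS]mul1r ler_nM2r// /sq_exponent.
  by rewrite expr_ge1// ler1n.
by move: (2^-1 ^+ K) (expR _) (expR _) e2 => h A B; nra.
Qed.

Let lacunary_partial_le_upper K L y : lacunary_partial K y <= upper L y.
Proof.
apply: (@le_trans _ _ (lacunary_partial (maxn K L) y)).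
  by apply: lacunary_partial_nd; exact: leq_maxl.
apply: (@le_trans _ _ (upper (maxn K L) y)).
  rewrite lerDl.
  by case: (negP y) => -[_ ->]; rewrite ?mul0r// mul1r mulr_ge0 ?expR_ge0 ?exprn_ge0.
by apply: upper_ni; exact: leq_maxr.
Qed.

Definition lacunary y : R := limn (lacunary_partial ^~ y).

Let lacunary_cvg y : lacunary_partial ^~ y @ \oo --> lacunary y.
Proof.
apply: nondecreasing_is_cvgn; first exact: lacunary_partial_nd.
by exists (upper 0 y) => _ [K _ <-].
Qed.

Lemma lacunary_ge K y : lacunary_partial K y <= lacunary y.
Proof.
apply: nondecreasing_cvgn_le; first exact: lacunary_partial_nd.
by apply/cvg_ex; eexists; exact: lacunary_cvg.
Qed.

Lemma lacunary_le K y : lacunary y <= lacunary_partial K y + 2^-1 ^+ K * expR y.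
Proof.
apply: (@le_trans _ _ (upper K y)).
  apply: limr_le; first by apply/cvg_ex; eexists; exact: lacunary_cvg.
  by near=> n; exact: lacunary_partial_le_upper.
rewrite /upper lerD2l; have h : 0 <= 2^-1 ^+ K * expR y.
  by rewrite mulr_ge0 ?expR_ge0 ?exprn_ge0.
by case: (negP y) => -[_ ->]; rewrite ?mul0r ?mul1r.
Unshelve. all: by end_near. Qed.

Lemma lacunary_pos y : 0 < y -> lacunary y = 0.
Proof.
move=> y0; have -> : lacunary y = limn (fun=> 0 : R).
  congr (limn _); apply/funext => K; rewrite /lacunary_partial.
  by case: (negP y) => -[]; [lra|move=> _ ->; rewrite mul0r].
by rewrite lim_cst.
Qed.

Lemma measurable_lacunary : measurable_fun [set: measurableTypeR R] lacunary.
Proof.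
apply: (@measurable_fun_cvg _ _ _ _ lacunary_partial) => [K|y _].
  apply: measurable_funM; first exact: measurable_indic.
  apply: measurable_sum => m; apply: measurable_funM => //.
  by apply: measurableT_comp => //; exact: measurable_funM.
exact: lacunary_cvg.
Qed.

Lemma lacunary_is_L2fun : (fun y => (lacunary y)%:C) \in is_L2fun wm.
Proof.
have mc : cmeasurable (fun y : measurableTypeR R => (lacunary y)%:C).
  by split; [exact: measurable_lacunary|exact: measurable_cst].
apply/is_L2funP; split => //; apply: le_lt_trans (L2fun_finite (sq_exp R 0)).
apply: Lnorm2_le => [||y].
- exact: measurable_cabs.
- exact: (measurable_cabs (L2fun_measurable _)).
rewrite normc_ge0 /cabs/= !expr0n/= !addr0 !sqrtr_sqr (ger0_norm (expR_ge0 _)).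
(* The case K = 0 encloses the series between 0 and e^y, the exponential of index 0. *)
have := lacunary_ge 0 y; have := lacunary_le 0 y.
rewrite /lacunary_partial big_ord0 mulr0 add0r expr0 !mul1r => h1 h2.
by rewrite ger0_norm// /sq_exponent expr1n mul1r.
Qed.

Definition lacunary_fun : L2fun wm := MkL2fun lacunary_is_L2fun.

Definition lacunary_coef m : R[i] := (2^-1 ^+ m.+1)%:C.

Lemma L2rnorm_lacunary_tail K :
  L2rnorm (L2class lacunary_fun - L2class (Pminus_fun (sq_exp_sum K lacunary_coef)))
  <= 2^-1 ^+ K * L2rnorm (L2class (sq_exp R 0)).
Proof.
have -> : 2^-1 ^+ K * L2rnorm (L2class (sq_exp R 0)) =
    L2rnorm (L2class ((2^-1 ^+ K)%:C *: sq_exp R 0)).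
  rewrite L2classZ; apply: complexI; rewrite -L2rnormE.
  rewrite [RHS](L2normZ _ (L2class (sq_exp R 0))) rmorphM.
  by rewrite ger0_norm ?lecR ?exprn_ge0.
rewrite -L2classB; apply: L2rnorm_class_le => y.
have -> : (lacunary_fun - Pminus_fun (sq_exp_sum K lacunary_coef)) y =
    (lacunary y - lacunary_partial K y)%:C.
  rewrite -[LHS]/((lacunary y)%:C - (neg y)%:C * _) sq_exp_sumE /lacunary_partial.
  rewrite rmorphB rmorphM rmorph_sum; congr (_ - _ * _).
  by apply: eq_bigr => m _; rewrite -rmorphM.
rewrite -[X in _ <= normc X]/(_%:C * _%:C) -rmorphM /= !expr0n/= !addr0 !sqrtr_sqr.
rewrite ger0_norm ?subr_ge0 ?lacunary_ge// ger0_norm; last first.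
  by rewrite mulr_ge0 ?expR_ge0 ?exprn_ge0.
by rewrite lerBlDl /sq_exponent expr1n mul1r lacunary_le.
Qed.

Lemma lacunary_L2neg : L2neg R (L2class lacunary_fun).
Proof.
apply: filterS (L2classK lacunary_fun) => y /= /(_ I) -> y0.
by rewrite lacunary_pos.
Qed.

End lacunary_series.

(** * The lacunary series as a limit outside the image *)

Section nonclosed_image.
Variable R : realType.
Local Notation wm := (@wmeasure R).
Local Notation L2w := (L2 wm).
Implicit Types (u v : L2w) (n : nat).

Lemma sq_span_large u : sq_span u ->
  exists K0, forall K, (K0 <= K)%N -> exists c, u = L2class (sq_exp_sum K c).
Proof.
move=> /sq_spanP[K0 [c ->]]; exists K0 => K K0K.
by exists (fun m => if (m < K0)%N then c m else 0); rewrite -sq_exp_sum_widen.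
Qed.

Lemma exprn_inv2_small (e : R) : 0 < e ->
  exists K0, forall K, (K0 <= K)%N -> 2^-1 ^+ K < e.
Proof.
move=> e0; have /cvgrPdist_lt/(_ e e0)[K0 _ H] : (2^-1 : R) ^+ n @[n --> \oo] --> 0.
  by apply: cvg_expr; rewrite ger0_norm// invf_lt1// ltr1n.
exists K0 => K /H /=; rewrite sub0r normrN ger0_norm// exprn_ge0//.
Qed.

(* If the lacunary series is the restriction of f, then the n-th coefficient
   of f is forced on (-oo, -1], and bounded by integrating up to 16. *)
Lemma lacunary_preimage_coef_le u n : closure (@sq_span R) u ->
  L2class (lacunary_fun R) = Pminus u ->
  2^-1 ^+ n.+1 <= Num.sqrt (coef_bound n (16 : R)) * L2rnorm u.
Proof.
move=> /closure_L2P uN uE; apply/ler_addgt0Pr => e e0.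
pose C1 : R := Num.sqrt (coef_bound n (-1 : R)).
pose C2 : R := Num.sqrt (coef_bound n (16 : R)).
have C10 : 0 <= C1 by exact: sqrtr_ge0.
have C20 : 0 <= C2 by exact: sqrtr_ge0.
(* The total error will be (2 [C1] + [C2]) [dl]; the 1 makes [C] positive. *)
pose C := 2 * C1 + C2 + 1.
have C0 : 0 < C by rewrite /C; lra.
pose dl := e / C.
have dl0 : 0 < dl by rewrite divr_gt0.
have [p /sq_span_large[K1 pE] up] := uN _ dl0.
pose E0 := L2rnorm (L2class (sq_exp R 0)).
have E00 : 0 <= E0 by exact: L2rnorm_ge0.
(* Dividing by [E0 + 1] avoids having to show that [E0] is nonzero. *)
have [K2 K2P] := @exprn_inv2_small (dl / (E0 + 1)) (divr_gt0 dl0 (ltr_wpDl E00 ltr01)).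
pose K := maxn n.+1 (maxn K1 K2).
have nK : (n < K)%N by rewrite leq_max leqnn.
have [|c pc] := pE K; first by rewrite !leq_max leqnn orbT.
have tail : 2^-1 ^+ K * E0 <= dl.
  have /K2P/ltW h : (K2 <= K)%N by rewrite !leq_max leqnn !orbT.
  apply: le_trans (ler_wpM2r E00 h) _; rewrite mulrAC ler_pdivrMr; last lra.
  by apply: ler_wpM2l; lra.
pose b := @lacunary_coef R.
pose g := Pminus_fun (sq_exp_sum K (fun m => c m - b m)).
have gE y : y <= -1 -> g y = sq_exp_sum K (fun m => c m - b m) y.
  exact: Pminus_fun_below.
have gle : L2rnorm (L2class g) <= 2 * dl.
  (* Since P_- u is the lacunary series, it can be inserted between P_- p and the partial sum; both
     differences are at most [dl]. *)
  have -> : L2class g = (L2class (lacunary_fun R) - L2class (Pminus_fun (sq_exp_sum K b)))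
      - Pminus (u - p).
    rewrite /g -sq_exp_sumB Pminus_funB L2classB pc PminusB -uE PminusE.
    by rewrite opprB [RHS]addrC addrA subrK.
  apply: le_trans (ler_L2rnormD _ _) _; rewrite mulrDl mul1r; apply: lerD.
    exact: le_trans (L2rnorm_lacunary_tail R K) tail.
  rewrite -[- Pminus _]sub0r L2rnormBC subr0.
  exact: le_trans (L2rnorm_Pminus_le _) (ltW up).
(* At s = -1 the coefficient of p is close to 2^(-(n + 1)); at s = 16 it is controlled by the norm
   of p. *)
have h1 := coef_norm_le nK gE.
have h2 := @coef_norm_le R (sq_exp_sum K c) K c n 16 nK (fun _ _ => erefl).
rewrite -pc in h2.
have h3 : L2rnorm p <= L2rnorm u + dl.
  rewrite -[p](subrK u) addrC; apply: le_trans (ler_L2rnormD _ _) _.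
  by rewrite lerD2l L2rnormBC ltW.
have h4 : normc (b n) = 2^-1 ^+ n.+1.
  by rewrite /b /lacunary_coef /= expr0n addr0 sqrtr_sqr ger0_norm ?exprn_ge0.
have h5 : normc (b n) <= normc (c n - b n) + normc (c n).
  rewrite (_ : normc (c n - b n) = normc (b n - c n)).
    by apply: le_trans (ler_normcD _ _); rewrite subrK.
  by rewrite -opprB; exact: normcN.
rewrite -h4; apply: le_trans h5 _; apply: le_trans (lerD h1 h2) _.
have -> : e = C * dl by rewrite /dl mulrC divfK ?gt_eqF.
rewrite -/C1 -/C2 /C.
have i1 : C1 * L2rnorm (L2class g) <= C1 * (2 * dl) by exact: ler_wpM2l.
have i2 : C2 * L2rnorm p <= C2 * (L2rnorm u + dl) by exact: ler_wpM2l.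
lra.
Qed.

Lemma lacunary_notin_image :
  ~ (Pminus @` closure (@sq_span R)) (L2class (lacunary_fun R)).
Proof.
move=> [u uN uE].
pose M : R := 4 * L2rnorm u ^+ 2 / weight 16.
have w0 : 0 < weight 16 :> R by exact: expR_gt0.
(* As 28 - 2 * 16 = -4, the squared coefficient bound decays like p^2 e^(-4 p^2) <= e^(-3 p),
   against 4^(-p) >= e^(-2 p). Hence p <= e^p <= [M] for every p, which is absurd. *)
suff H n : n.+1%:R <= M.
  have [k Mk] : exists k : nat, M < k.+1%:R.
    by exists (Num.truncn M); exact: truncnS_gt.
  by move: (H k); rewrite leNgt Mk.
set p : R := n.+1%:R.
have p1 : 1 <= p by rewrite ler1n.
have := lacunary_preimage_coef_le n uN (esym uE).
rewrite -ler_sqr ?nnegrE ?mulr_ge0 ?sqrtr_ge0 ?L2rnorm_ge0 ?exprn_ge0//.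
rewrite exprMn sqr_sqrtr ?coef_bound_ge0// /coef_bound => h.
have e2 : expR (- (2 * p)) <= (2^-1 ^+ n.+1) ^+ 2.
  rewrite -exprM (_ : - (2 * p) = - 1 * (n.+1 * 2)%:R); last by rewrite natrM /p; ring.
  rewrite expRM_natr lerXn2r// ?nnegrE ?expR_ge0// expRN lef_pV2 ?posrE ?expR_gt0//.
  by apply: le_trans (expR_ge1Dx _); lra.
have e3 : sq_exponent R n * expR ((28 - 2 * 16) * sq_exponent R n) <= expR (- (3 * p)).
  apply: (@le_trans _ _ (expR (p ^+ 2) * expR ((28 - 2 * 16) * p ^+ 2))).
    by apply: ler_wpM2r; [exact: expR_ge0|apply: le_trans (expR_ge1Dx _); rewrite lerDr].
  by rewrite -expRD ler_expR expr2; nra.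
have {e2 e3}h : expR (- (2 * p)) <= M * expR (- (3 * p)).
  apply: le_trans e2 _; apply: le_trans h _.
  rewrite (_ : M * _ = 4 * expR (- (3 * p)) / weight 16 * L2rnorm u ^+ 2); last by rewrite /M; ring.
  apply: ler_wpM2r; first exact: sqr_ge0.
  apply: ler_wpM2r; first by rewrite invr_ge0 ltW.
  by rewrite -mulrA; apply: ler_wpM2l.
have {h} := ler_wpM2r (expR_ge0 (3 * p)) h.
rewrite -mulrA -!expRD addNr expR0 mulr1; apply: le_trans.
by apply: le_trans (expR_ge1Dx _); lra.
Qed.

Lemma Pminus_image_not_closed :
  ~ closed_in (L2neg R) (Pminus @` closure (@sq_span R)).
Proof.
(* Relative closedness yields a closed [B] with the same trace on [L2neg]. It contains the projected
   partial sums, hence their limit, which lies in [L2neg] and so would be in the image. *)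
move=> /closed_subspaceP[B cB BE]; apply: lacunary_notin_image.
have vneg := lacunary_L2neg R.
suff vB : B (L2class (lacunary_fun R)).
  by have [] : (Pminus @` closure (@sq_span R) `&` L2neg R) (L2class (lacunary_fun R)) by rewrite -BE.
rewrite (closure_id B).1//; apply/closure_L2P => e e0.
pose E0 := L2rnorm (L2class (sq_exp R 0)).
have E00 : 0 <= E0 by exact: L2rnorm_ge0.
have [K /(_ K (leqnn K)) KP] := exprn_inv2_small (divr_gt0 e0 (ltr_wpDl E00 ltr01)).
pose p := L2class (sq_exp_sum K (@lacunary_coef R)).
exists (Pminus p).
  suff : (Pminus @` closure (@sq_span R) `&` L2neg R) (Pminus p) by rewrite -BE => -[].
  split; last exact: Pminus_L2neg.
  by exists p => //; apply: subset_closure; apply/sq_spanP; exists K, (@lacunary_coef R).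
rewrite PminusE; apply: le_lt_trans (L2rnorm_lacunary_tail R K) _.
rewrite -/E0; apply: (@le_lt_trans _ _ (2^-1 ^+ K * (E0 + 1) - 2^-1 ^+ K)); first lra.
rewrite ltr_pdivlMr in KP; last lra.
by have : 0 <= 2^-1 ^+ K :> R; [rewrite exprn_ge0|lra].
Qed.

End nonclosed_image.

Local Close Scope complex_scope.

Theorem mainTheorem7 (R : realType) :
  exists N : set (L2 (@wmeasure R)),
    [/\ GRing.submod_closed (mem N),
        closed N,
        forall t : {nonneg R}, right_shift t @` N `<=` N,
        ~ closed_in (L2neg R) (Pminus @` N)
      & N = closure (lin_span (range (fun n : nat => expo (n.+1%:R ^+ 2)%:pos)))].
Proof.
exists (closure (@sq_span R)); split.
- exact/closure_submod/lin_span_submod.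
- exact: closed_closure.
(* A contraction preserving the span preserves its closure. *)
- move=> t; apply: closure_image_sub; last exact: right_shift_sq_span.
  by move=> u v; rewrite -right_shiftB !L2rnormE lecR L2rnorm_right_shift_le.
- exact: Pminus_image_not_closed.
- by [].
Qed.
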